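(* Let $n, m, d$ be positive integers with $m>n$, let $0<\eta<1$, and let $\beta = 3\sqrt{n/m}$. Let $\mathcal{C}$ be any binary linear code of message length $n$, blocklength $m$, and dual distance $d$. Then no threshold distinguisher of size $N < \tfrac17 \exp[\min\{\eta d/6,\, 3n\}]$ correctly decides, for all $w\in\mathbb{F}_2^m$, whether $w$ is $\eta$-close to or $\beta$-separated from $\mathcal{C}$; that is, there is no such distinguisher that accepts every $w$ that is $\eta$-close to $\mathcal{C}$ and rejects every $w$ that is $\beta$-separated from $\mathcal{C}$.
   Context: All vectors are over $\mathbb{F}_2$. The code is $\mathcal{C}=\{Cx : x\in\mathbb{F}_2^n\}$ for a full-rank $C\in\mathbb{F}_2^{m\times n}$. The dual code is $\mathcal{C}^\perp=\{h\in\mathbb{F}_2^m : \langle h,v\rangle = 0 \ \forall v\in\mathcal{C}\}$, and the dual distance is the minimum Hamming weight of a nonzero element of $\mathcal{C}^\perp$. $\mathrm{wt}$ denotes Hamming weight, $\mathrm{dist}(\mathcal{C},w)=\min_{v\in\mathcal{C}}\mathrm{wt}(v+w)$. A vector $w$ is $\eta$-close to $\mathcal{C}$ if $\mathrm{dist}(\mathcal{C},w)\le \eta m$. A vector $u$ is $\beta$-balanced if $\mathrm{wt}(u)\in[\tfrac12(1-\beta)m,\tfrac12(1+\beta)m]$, and $w$ is $\beta$-separated from $\mathcal{C}$ if $w+v$ is $\beta$-balanced for every $v\in\mathcal{C}$. A threshold distinguisher of size $N$ is given by a matrix $H\in\mathbb{F}_2^{N\times m}$ with rows $h_1,\dots,h_N$,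 a shift vector $b\in\mathbb{F}_2^N$, and a threshold $T\in\mathbb{R}$; on input $w$ it computes $A_{H,b}(w)=\sum_{i=1}^N (-1)^{\langle h_i,w\rangle + b_i}$ and decides by comparing $A_{H,b}(w)$ with $T$ (accepting exactly when $A_{H,b}(w)\ge T$, or, alternatively, exactly when $A_{H,b}(w)\le T$). *)

(* Defs.v *)
From HB Require Import structures.
From mathcomp Require Import all_boot all_order all_algebra.
From mathcomp Require Import reals.

Set Implicit Arguments.
Unset Strict Implicit.
Unset Printing Implicit Defensive.

Import Order.TTheory GRing.Theory Num.Theory.

Local Open Scope ring_scope.

Section Codes.
Variable m : nat.
Implicit Types (S : {set 'cV['F_2]_m}) (u v w h : 'cV['F_2]_m).

Definition dotp h v : 'F_2 := \sum_(i < m) h i 0 * v i 0.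

Definition wt u : nat := #|[set i : 'I_m | u i 0 != 0]|.

Definition code n (C : 'M['F_2]_(m, n)) : {set 'cV['F_2]_m} :=
  [set C *m x | x : 'cV['F_2]_n].

Definition dual S : {set 'cV['F_2]_m} :=
  [set h | [forall v in S, dotp h v == 0]].

(* Weights are at most m, so starting the minimum at m leaves it unchanged
   whenever it ranges over a nonempty set: the dual of a code of dimension
   n < m has a nonzero element, and every code contains 0. *)
Definition dual_distance S : nat :=
  \big[minn/m]_(h in dual S | h != 0) wt h.

Definition code_dist S w : nat := \big[minn/m]_(v in S) wt (v + w).

Variable R : realType.

Definition close_to (eta : R) S w : Prop := (code_dist S w)%:R <= eta * m%:R.

Definition is_balanced (beta : R) u : Prop :=
  (1 - beta) * m%:R / 2 <= (wt u)%:R <= (1 + beta) * m%:R / 2.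

Definition separated_from (beta : R) S w : Prop :=
  forall v, v \in S -> is_balanced beta (w + v).

Variant acceptance := AcceptGe | AcceptLe.

Record threshold_distinguisher (N : nat) := ThresholdDistinguisher {
  test_mx : 'M['F_2]_(N, m);
  shift_vec : 'cV['F_2]_N;
  threshold : R;
  accept_mode : acceptance }.

(* The exponent is the representative in {0, 1} of <h_i, w> + b_i. *)
Definition statistic N (H : 'M['F_2]_(N, m)) (b : 'cV['F_2]_N) w : R :=
  \sum_(i < N) (-1) ^+ nat_of_ord (dotp (row i H)^T w + b i 0).

Definition accepts N (D : threshold_distinguisher N) w : Prop :=
  match accept_mode D with
  | AcceptGe => threshold D <= statistic (test_mx D) (shift_vec D) w
  | AcceptLe => statistic (test_mx D) (shift_vec D) w <= threshold D
  end.

End Codes.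

(* Main.v *)
Require Import Defs.
From HB Require Import structures.
From mathcomp Require Import all_boot all_order all_algebra.
From mathcomp Require Import reals sequences exp.
From mathcomp Require Import ring lra.

Import Order.TTheory GRing.Theory Num.Theory.

Local Open Scope ring_scope.

(* Compare the statistic A under two random inputs: w = C x + e with x uniform
   and e of independent Bernoulli(eta/2) entries, and w uniform.  A character
   w |-> (-1)^<h, w> has mean [h in dual](1 - eta)^(wt h) under the first and
   [h = 0] under the second, so the means of A differ by at most
   N exp(- eta d).  The first input is eta-close except with probability
   exp(- eta m / 6) (Chernoff) and the second is beta-separated except with
   probability 2 exp(- 3 n) (Hoeffding and a union bound over the code).  Since
   A is integer valued and bounded by N, a threshold that works would separate
   the two means by at least 1 - 2 N exp(- eta d / 6) - 4 N exp(- 3 n); hence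
   7 N >= exp(min(eta d / 6, 3 n)). *)

(** * Numerical bounds on the exponential and the hyperbolic cosine *)

Section ExpBounds.
Variable R : realType.
Implicit Types x y z : R.

Lemma expR_le_divB1 x : x < 1 -> expR x <= (1 - x)^-1.
Proof.
move=> x1; rewrite -[x in expR x]opprK expRN lef_pV2 ?posrE ?expR_gt0 ?subr_gt0 //.
exact: expR_ge1Dx.
Qed.

Definition coshR x := (expR x + expR (- x)) / 2.

Lemma coshR_ge0 x : 0 <= coshR x.
Proof. by rewrite /coshR divr_ge0 ?addr_ge0 ?expR_ge0. Qed.

Lemma coshR_double x : coshR (2 * x) = 2 * coshR x ^+ 2 - 1.
Proof.
rewrite /coshR -mulrN !expRM_natl.
have : expR x * expR (- x) = 1 by rewrite -expRD subrr expR0.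
set a := expR x; set b := expR (- x) => ab.
have -> : a ^+ 2 + b ^+ 2 = (a + b) ^+ 2 - 2 * (a * b) by ring.
by rewrite ab; field.
Qed.

(** With [x = 2 * z], cosh x is 1 + 2 sinh(z)^2, and sinh z is at most [23 / 22 * z]. The sharp
    coefficient is 1/2; the slack up to [9 / 16] still suffices for the final exponent. *)
Lemma coshR_near0 x : 0 <= x <= 6^-1 -> coshR x <= 1 + 9 / 16 * x ^+ 2.
Proof.
move=> /andP[x0 x6]; set z := x / 2.
have -> : x = 2 * z by rewrite /z; field.
have z0 : 0 <= z by rewrite /z; lra.
have z12 : z <= 12^-1 by rewrite /z; lra.
rewrite coshR_double /coshR.
have ab : expR z * expR (- z) = 1 by rewrite -expRD subrr expR0.
have b_ge : 1 - z <= expR (- z) by exact: expR_ge1Dx.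
have a_ge : 1 + z <= expR z by exact: expR_ge1Dx.
move: ab b_ge a_ge; set a := expR z; set b := expR (- z) => ab b_ge a_ge.
(* From [a <= (1 - z)^-1 = 1 + z / (1 - z)] and [z <= 12^-1]. *)
have a_le : a <= 1 + 12 / 11 * z.
  have a_le1 : a * (1 - z) <= 1 by rewrite -ab ler_wpM2l //; lra.
  nra.
have b_le1 : b <= 1 by nra.
have -> : 2 * ((a + b) / 2) ^+ 2 - 1 = 1 + 2 * ((a - b) / 2) ^+ 2.
  have -> : 1 + 2 * ((a - b) / 2) ^+ 2 = 1 + 2 * ((a + b) / 2) ^+ 2 - 2 * (a * b).
    by field.
  by rewrite ab; ring.
have s0 : 0 <= (a - b) / 2 by lra.
have s1 : (a - b) / 2 <= 23 / 22 * z by lra.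
rewrite lerD2l; move: s0 s1; set s := (a - b) / 2 => s0 s1.
nra.
Qed.

(* With e = expR (c x^2), cosh (2 x) <= 2 e^2 - 1 <= e^4. *)
Lemma coshR_double_le c x :
  coshR x <= expR (c * x ^+ 2) -> coshR (2 * x) <= expR (c * (2 * x) ^+ 2).
Proof.
move=> cx; rewrite coshR_double.
have -> : c * (2 * x) ^+ 2 = 4 * (c * x ^+ 2) by ring.
rewrite expRM_natl; set e := expR _ in cx *.
have c0 := coshR_ge0 x.
have h : coshR x ^+ 2 <= e ^+ 2 by rewrite lerXn2r ?nnegrE // expR_ge0.
have := sqr_ge0 (e ^+ 2 - 1); nra.
Qed.

(** Four doublings start from [x / 16], and [8 / 3 / 16 = 6^-1] is the limit of the estimate near
    0. *)
Lemma coshR_le x : 0 <= x <= 8 / 3 -> coshR x <= expR (9 / 16 * x ^+ 2).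
Proof.
move=> /andP[x0 x1]; set y := x / 16.
have -> : x = 2 * (2 * (2 * (2 * y))) by rewrite /y; field.
do 4! apply: coshR_double_le.
apply: le_trans (expR_ge1Dx _); apply: coshR_near0; rewrite /y; lra.
Qed.

(** [expR 24^-1 <= 24 / 23] is squared four times, with rounding up to three decimals in between.
    The bound serves the Chernoff estimate with parameter [2 / 3]. *)
Lemma expR_two_thirds_le2 : expR (2 / 3 : R) <= 2.
Proof.
set e := expR (24^-1 : R).
have e0 : 0 <= e by exact: expR_ge0.
have -> : 2 / 3 = 16 * 24^-1 :> R by field.
have -> : expR (16 * 24^-1) = (((e ^+ 2) ^+ 2) ^+ 2) ^+ 2.
  by rewrite expRM_natl -/e; ring.
have sqr_le (u v w : R) : 0 <= u -> u <= v -> v ^+ 2 <= w -> u ^+ 2 <= w.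
  by move=> u0 uv; apply: le_trans; rewrite lerXn2r ?nnegrE // (le_trans u0).
apply: (@sqr_le _ (1407 / 1000)); rewrite ?exprn_ge0 //; last lra.
apply: (@sqr_le _ (1186 / 1000)); rewrite ?exprn_ge0 //; last lra.
apply: (@sqr_le _ (1089 / 1000)); rewrite ?exprn_ge0 //; last lra.
apply: (@sqr_le _ (24 / 23)) => //; last lra.
have -> : 24 / 23 = (1 - 24^-1)^-1 :> R by field.
by apply: expR_le_divB1; lra.
Qed.

End ExpBounds.

(** * Bounds on a mean from bounds on a likely event *)

Section Averaging.
Variables (R : realDomainType) (T : finType) (p f : T -> R) (G : pred T) (a B : R).
Hypotheses (p_ge0 : forall t, 0 <= p t) (p_sum1 : \sum_t p t = 1).

(** Outside [G], the assumption [a <= B] gives [f t >= - B >= a - 2 * B]. *)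
Lemma mean_ge : (forall t, - B <= f t) -> (forall t, G t -> a <= f t) -> a <= B ->
  a - 2 * B * \sum_(t | ~~ G t) p t <= \sum_t p t * f t.
Proof.
move=> fB fG aB.
have -> : a - 2 * B * \sum_(t | ~~ G t) p t =
    \sum_t p t * (a - 2 * B * (~~ G t)%:R).
  under [RHS]eq_bigr do rewrite mulrBr.
  rewrite sumrB -mulr_suml p_sum1 mul1r; congr (_ - _).
  rewrite big_mkcond mulr_sumr; apply: eq_bigr => t _.
  by case: (G t) => /=; ring.
apply: ler_sum => t _; apply: ler_wpM2l => //.
case: (boolP (G t)) => /= Gt; first by rewrite mulr0 subr0 fG.
by rewrite mulr1; have := fB t; lra.
Qed.

End Averaging.

Lemma mean_le (R : realDomainType) (T : finType) (p f : T -> R) (G : pred T) (a B : R) :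
  (forall t, 0 <= p t) -> \sum_t p t = 1 ->
  (forall t, f t <= B) -> (forall t, G t -> f t <= a) -> - B <= a ->
  \sum_t p t * f t <= a + 2 * B * \sum_(t | ~~ G t) p t.
Proof.
move=> p0 p1 fB fG aB.
have := @mean_ge R T p (fun t => - f t) G (- a) B p0 p1.
under [X in _ -> _ -> _ -> _ <= X]eq_bigr do rewrite mulrN.
rewrite sumrN => h.
rewrite -lerN2 opprD h //.
- by move=> t; rewrite lerN2.
- by move=> t Gt; rewrite lerN2 fG.
- by lra.
Qed.

(** * Characters and tail bounds for independent Bernoulli bits *)

Section Characters.
Variable R : realType.

Definition sgn2 (a : 'F_2) : R := (-1) ^+ nat_of_ord a.

Lemma F2_cases (a : 'F_2) : a = 0 \/ a = 1.
Proof. by case: a => [[|[|k]] lt_k] //; [left|right]; apply: val_inj. Qed.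

Lemma sum_F2 (F : 'F_2 -> R) : \sum_a F a = F 0 + F 1.
Proof.
rewrite (bigD1 (0 : 'F_2)) //= (bigD1 (1 : 'F_2)) //= big1 ?addr0 // => a.
by case: (F2_cases a) => ->.
Qed.

Lemma sgn20 : sgn2 0 = 1. Proof. by []. Qed.
Lemma sgn21 : sgn2 1 = -1. Proof. by []. Qed.

Lemma sgn2D a b : sgn2 (a + b) = sgn2 a * sgn2 b.
Proof.
case: (F2_cases a) => ->; first by rewrite add0r mul1r.
case: (F2_cases b) => ->; first by rewrite addr0 mulr1.
by rewrite sgn21 mulrNN mulr1.
Qed.

Lemma norm_sgn2 a : `|sgn2 a| = 1.
Proof. by rewrite /sgn2 normrX normrN1 expr1n. Qed.

Lemma sgn2_sum (I : finType) (F : I -> 'F_2) : sgn2 (\sum_i F i) = \prod_i sgn2 (F i).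
Proof. exact: (big_morph sgn2 sgn2D sgn20). Qed.

(** Distributivity, with vectors viewed as functions on the indices: this is how independence of the
    coordinates enters. *)
Lemma sum_cV_prod m (F : 'I_m -> 'F_2 -> R) :
  \sum_(e : 'cV['F_2]_m) \prod_i F i (e i 0) = \prod_i \sum_a F i a.
Proof.
rewrite bigA_distr_bigA /=.
rewrite (reindex (fun f : {ffun 'I_m -> 'F_2} => \col_i f i)) /=.
  by apply: eq_bigr => f _; apply: eq_bigr => i _; rewrite mxE.
exists (fun e : 'cV['F_2]_m => [ffun i => e i 0]) => [f _|e _].
  by apply/ffunP => i; rewrite ffunE mxE.
by apply/colP => i; rewrite mxE ffunE.
Qed.

Lemma prod_wt m (s : R) (e : 'cV['F_2]_m) :
  \prod_i (if e i 0 == 0 then 1 else s) = s ^+ wt e.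
Proof.
rewrite /wt -prodr_const [RHS]big_mkcond /=; apply: eq_bigr => i _.
by rewrite inE; case: eqP.
Qed.

(** Probability mass of [e] under independent Bernoulli([r]) entries; [r = 2^-1] is the uniform law,
    so both random inputs share the lemmas below. *)
Definition bernoulli_wt m (r : R) (e : 'cV['F_2]_m) : R :=
  \prod_i (if e i 0 == 0 then 1 - r else r).

Lemma bernoulli_wt_ge0 m r (e : 'cV['F_2]_m) : 0 <= r <= 1 -> 0 <= bernoulli_wt m r e.
Proof. by move=> r01; apply: prodr_ge0 => i _; case: eqP => _; lra. Qed.

Lemma bernoulli_mgf m r s :
  \sum_(e : 'cV['F_2]_m) bernoulli_wt m r e * s ^+ wt e = (1 - r + r * s) ^+ m.
Proof.
under eq_bigr do rewrite -prod_wt -big_split /=.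
rewrite (sum_cV_prod m (fun _ a => (if a == 0 then 1 - r else r) * (if a == 0 then 1 else s))).
under eq_bigr do rewrite sum_F2 eqxx oner_eq0 mulr1.
by rewrite prodr_const card_ord.
Qed.

Lemma bernoulli_sum1 m r : \sum_(e : 'cV['F_2]_m) bernoulli_wt m r e = 1.
Proof.
have := bernoulli_mgf m r 1; rewrite mulr1 subrK expr1n => <-.
by apply: eq_bigr => e _; rewrite expr1n mulr1.
Qed.

(** A coordinate in the support of [h] contributes [(1 - r) - r], any other contributes 1. At
    [r = 2^-1] the value [0 ^+ wt h] is the indicator of [h = 0]. *)
Lemma bernoulli_character m r (h : 'cV['F_2]_m) :
  \sum_(e : 'cV['F_2]_m) bernoulli_wt m r e * sgn2 (dotp h e) = (1 - 2 * r) ^+ wt h.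
Proof.
under eq_bigr do rewrite /dotp sgn2_sum -big_split /=.
rewrite (sum_cV_prod m (fun i a => (if a == 0 then 1 - r else r) * sgn2 (h i 0 * a))).
rewrite -prod_wt; apply: eq_bigr => i _.
rewrite sum_F2 eqxx oner_eq0 mulr0 sgn20 !mulr1.
by case: (F2_cases (h i 0)) => ->; rewrite ?eqxx ?oner_eq0 ?sgn20 ?sgn21; ring.
Qed.

Lemma bernoulli_half m (e : 'cV['F_2]_m) : bernoulli_wt m 2^-1 e = 2^-1 ^+ m.
Proof.
rewrite /bernoulli_wt -[in RHS](card_ord m) -prodr_const.
by apply: eq_bigr => i _; case: eqP => _ //; lra.
Qed.

Lemma wt_eq0 m (h : 'cV['F_2]_m) : (wt h == 0%N) = (h == 0).
Proof.
rewrite /wt cards_eq0; apply/eqP/eqP => [h0|->].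
  apply/colP => i; rewrite mxE; apply/eqP; apply: contraT => hi.
  by have := in_set0 i; rewrite -h0 inE hi.
by apply/setP => i; rewrite !inE mxE eqxx.
Qed.

Lemma wt0 m : wt (0 : 'cV['F_2]_m) = 0%N.
Proof. by apply/eqP; rewrite wt_eq0. Qed.

(* Markov's inequality for expR (s * wt e). *)
Lemma bernoulli_tail m r s t : 0 <= r <= 1 ->
  \sum_(e : 'cV['F_2]_m | t <= s * (wt e)%:R) bernoulli_wt m r e <=
  (1 - r + r * expR s) ^+ m * expR (- t).
Proof.
move=> r01; rewrite -bernoulli_mgf mulr_suml big_mkcond /=.
apply: ler_sum => e _; have p0 := @bernoulli_wt_ge0 m r e r01.
case: ifP => [te|_]; last by rewrite !mulr_ge0 ?exprn_ge0 ?expR_ge0.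
rewrite -mulrA ler_peMr // -expRM_natl -expRD.
by rewrite -[leLHS]expR0 ler_expR mulrC; lra.
Qed.

(** Chernoff bound at twice the mean, with parameter [2 / 3]: each coordinate costs
    [eta / 2 - 2 / 3 * eta = - eta / 6] in the exponent. *)
Lemma bernoulli_heavy m (eta : R) : 0 < eta < 1 ->
  \sum_(e : 'cV['F_2]_m | eta * m%:R < (wt e)%:R) bernoulli_wt m (eta / 2) e <=
  expR (- (eta * m%:R / 6)).
Proof.
move=> eta01; have r01 : 0 <= eta / 2 <= 1 by lra.
apply: le_trans (_ : \sum_(e : 'cV['F_2]_m | 2 / 3 * (eta * m%:R) <= 2 / 3 * (wt e)%:R)
    bernoulli_wt m (eta / 2) e <= _).
  rewrite big_mkcond [leRHS]big_mkcond /=; apply: ler_sum => e _.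
  case: ifP => [lt_e|_]; first by rewrite ifT // ler_pM2l ?ltW //; lra.
  by case: ifP => // _; apply: bernoulli_wt_ge0.
apply: le_trans (bernoulli_tail _ _ _ _ r01) _.
have e0 := expR_ge0 (2 / 3 : R).
have e2 := expR_two_thirds_le2 R.
have base : 1 - eta / 2 + eta / 2 * expR (2 / 3) <= expR (eta / 2).
  apply: le_trans (expR_ge1Dx _); nra.
apply: le_trans (_ : expR (eta / 2) ^+ m * expR (- (2 / 3 * (eta * m%:R))) <= _).
  rewrite ler_wpM2r ?expR_ge0 // lerXn2r ?nnegrE ?expR_ge0 //; nra.
rewrite -expRM_natl -expRD ler_expR; lra.
Qed.

Lemma uniform_unbalanced m (beta : R) : 0 <= beta <= 3 ->
  \sum_(u : 'cV['F_2]_m |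
      ~~ ((1 - beta) * m%:R / 2 <= (wt u)%:R <= (1 + beta) * m%:R / 2))
    bernoulli_wt m 2^-1 u <= 2 * expR (- (4 / 9 * beta ^+ 2 * m%:R)).
Proof.
move=> b03; have r01 : 0 <= (2^-1 : R) <= 1 by lra.
(* This [l] minimizes [9 / 16 * l ^+ 2 - l * beta], with value [- 4 / 9 * beta ^+ 2]; [beta <= 3]
   ensures [l <= 8 / 3]. *)
set l := 8 / 9 * beta.
have cl : coshR R l <= expR (9 / 16 * l ^+ 2) by apply: coshR_le; rewrite /l; lra.
have half s : 1 - 2^-1 + 2^-1 * expR (2 * s) = expR s * coshR R s.
  rewrite /coshR mulrA mulrDr -!expRD subrr expR0 (_ : 2 * s = s + s); first lra.
  by ring.
have coshN : coshR R (- l) = coshR R l by rewrite /coshR opprK addrC.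
(* One bound for both tails: [s = l] catches weights that are too large, [s = - l] those that are
   too small. *)
have tail s : coshR R s = coshR R l ->
    \sum_(u : 'cV['F_2]_m | s * m%:R + l * beta * m%:R <= 2 * s * (wt u)%:R)
      bernoulli_wt m 2^-1 u <= expR (- (4 / 9 * beta ^+ 2 * m%:R)).
  move=> cs; apply: le_trans (bernoulli_tail _ _ _ _ r01) _.
  rewrite half cs exprMn -expRM_natl mulrAC -expRD.
  apply: le_trans (ler_wpM2l (expR_ge0 _) (_ : _ <= expR (9 / 16 * l ^+ 2) ^+ m)) _.
    by rewrite lerXn2r ?nnegrE ?coshR_ge0 ?expR_ge0 //.
  rewrite -expRM_natl -expRD ler_expR /l le_eqVlt; apply/orP; left.
  by apply/eqP; field.
have -> : 2 * expR (- (4 / 9 * beta ^+ 2 * m%:R)) =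
  expR (- (4 / 9 * beta ^+ 2 * m%:R)) + expR (- (4 / 9 * beta ^+ 2 * m%:R)) by ring.
apply: le_trans (lerD (tail l erefl) (tail (- l) coshN)).
rewrite big_mkcond [X in _ <= X + _]big_mkcond [X in _ <= _ + X]big_mkcond -big_split /=.
apply: ler_sum => u _; have p0 := @bernoulli_wt_ge0 m 2^-1 u r01.
have m0 : 0 <= m%:R :> R by rewrite ler0n.
have l0 : 0 <= l by rewrite /l; lra.
case: ifP => [|_]; last by apply: addr_ge0; case: ifP.
rewrite negb_and -!ltNge => /orP[lo|hi].
- rewrite addrC ifT; last by nra.
  by rewrite lerDl; case: ifP.
- rewrite ifT; last by nra.
  by rewrite lerDl; case: ifP.
Qed.

End Characters.

(** * The noisy codeword and the uniform word, relative to the code *)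

Section Code.
Variables (R : realType) (m n : nat) (C : 'M['F_2]_(m, n)).
Implicit Types (h w e : 'cV['F_2]_m) (x : 'cV['F_2]_n).

Lemma dotpE k (h v : 'cV['F_2]_k) : dotp h v = (h^T *m v) 0 0.
Proof. by rewrite mxE; apply: eq_bigr => i _; rewrite mxE. Qed.

Lemma dotpDr k (h u v : 'cV['F_2]_k) : dotp h (u + v) = dotp h u + dotp h v.
Proof. by rewrite !dotpE mulmxDr mxE. Qed.

Lemma dotp_mulmx h x : dotp h (C *m x) = dotp (C^T *m h) x.
Proof. by rewrite !dotpE trmx_mul trmxK mulmxA. Qed.

Lemma mem_dual_code h : C^T *m h = 0 -> h \in dual (code C).
Proof.
move=> Ch0; rewrite inE; apply/forall_inP => v /imsetP[x _ ->].
by rewrite dotp_mulmx Ch0 dotpE trmx0 mul0mx mxE.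
Qed.

Lemma dual_distance_le (S : {set 'cV['F_2]_m}) h :
  h \in dual S -> h != 0 -> (dual_distance S <= wt h)%N.
Proof.
move=> hS h0; rewrite /dual_distance -minEnat -leEnat.
by apply: bigmin_le_cond; rewrite hS h0.
Qed.

(** The minimum starts at [m]. This lets the Chernoff error in [m] be absorbed into an error in the
    dual distance. *)
Lemma dual_distance_le_length (S : {set 'cV['F_2]_m}) : (dual_distance S <= m)%N.
Proof. by rewrite /dual_distance -minEnat -leEnat; apply: bigmin_le_id. Qed.

Lemma code_dist_le x e : (code_dist (code C) (C *m x + e)%R <= wt e)%N.
Proof.
have -> : wt e = wt (C *m (- x) + (C *m x + e)) by rewrite mulmxN addKr.
rewrite /code_dist -minEnat -leEnat.
by apply: (bigmin_le_cond _ (fun v => wt (v + (C *m x + e)))); apply: imset_f.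
Qed.

(** The law is kept on pairs (message, noise) instead of on words [C *m x + e], so that means
    factor. *)
Definition noisy_wt (r : R) (t : 'cV['F_2]_n * 'cV['F_2]_m) : R :=
  bernoulli_wt R n 2^-1 t.1 * bernoulli_wt R m r t.2.

Lemma noisy_wt_ge0 r t : 0 <= r <= 1 -> 0 <= noisy_wt r t.
Proof. by move=> r01; rewrite mulr_ge0 ?bernoulli_wt_ge0 //; lra. Qed.

Lemma noisy_sum r (f : 'cV['F_2]_n -> R) (g : 'cV['F_2]_m -> R) :
  \sum_t noisy_wt r t * (f t.1 * g t.2) =
  (\sum_x bernoulli_wt R n 2^-1 x * f x) * (\sum_e bernoulli_wt R m r e * g e).
Proof.
rewrite mulr_suml; under [RHS]eq_bigr do rewrite mulr_sumr.
by rewrite pair_bigA /=; apply: eq_bigr => t _; rewrite mulrACA.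
Qed.

Lemma noisy_sum1 r : \sum_t noisy_wt r t = 1.
Proof.
have := noisy_sum r (fun=> 1) (fun=> 1).
under [X in X = _]eq_bigr do rewrite !mulr1.
under [X in _ = X * _]eq_bigr do rewrite mulr1.
under [X in _ = _ * X]eq_bigr do rewrite mulr1.
by rewrite !bernoulli_sum1 mulr1.
Qed.

(** Moving [C] across the pairing, the uniform message contributes the indicator of [C^T *m h = 0],
    that is, of [h] lying in the dual code. *)
Lemma noisy_character r h :
  \sum_t noisy_wt r t * sgn2 R (dotp h (C *m t.1 + t.2)) =
  0 ^+ wt (C^T *m h) * (1 - 2 * r) ^+ wt h.
Proof.
under eq_bigr do rewrite dotpDr sgn2D dotp_mulmx.
rewrite (noisy_sum r (fun x => sgn2 R (dotp (C^T *m h) x)) (fun e => sgn2 R (dotp h e))).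
by rewrite !bernoulli_character divff ?pnatr_eq0 // subrr.
Qed.

(** The distance is at most the weight of the noise, so a far word forces heavy noise; the message
    then sums out. *)
Lemma noisy_far (eta : R) : 0 < eta < 1 ->
  \sum_(t | ~~ ((code_dist (code C) (C *m t.1 + t.2))%:R <= eta * m%:R))
    noisy_wt (eta / 2) t <= expR (- (eta * m%:R / 6)).
Proof.
move=> eta01; apply: le_trans (bernoulli_heavy R m eta eta01).
set far := fun e : 'cV['F_2]_m => eta * m%:R < (wt e)%:R.
have -> : \sum_(e | far e) bernoulli_wt R m (eta / 2) e =
    \sum_t noisy_wt (eta / 2) t * (1 * (far t.2)%:R).
  rewrite (noisy_sum (eta / 2) (fun=> 1) (fun e => (far e)%:R)).
  under [X in _ = X * _]eq_bigr do rewrite mulr1.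
  rewrite bernoulli_sum1 mul1r big_mkcond; apply: eq_bigr => e _.
  by case: (far e); rewrite ?mulr1 ?mulr0.
rewrite big_mkcond; apply: ler_sum => t _; rewrite mul1r.
have p0 : 0 <= noisy_wt (eta / 2) t by apply: noisy_wt_ge0; lra.
case: ifP => [|_]; last by rewrite mulr_ge0.
rewrite -ltNge => lt_dist.
suff -> : far t.2 by rewrite mulr1.
by apply: lt_le_trans lt_dist _; rewrite ler_nat code_dist_le.
Qed.

(** Boolean, to index sums, and quantified over messages, for the union bound. *)
Definition separatedb (beta : R) w :=
  [forall x, (1 - beta) * m%:R / 2 <= (wt (w + C *m x))%:R <= (1 + beta) * m%:R / 2].

Lemma separatedbP beta w : separatedb beta w -> separated_from beta (code C) w.
Proof. by move=> /forallP sep v /imsetP[x _ ->]; apply: sep. Qed.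

(** Union bound over the [2 ^+ n] messages; the uniform law is invariant under translation by each
    codeword. *)
Lemma uniform_not_separated (beta : R) : 0 <= beta <= 3 ->
  \sum_(w | ~~ separatedb beta w) bernoulli_wt R m 2^-1 w <=
  2 ^+ n * (2 * expR (- (4 / 9 * beta ^+ 2 * m%:R))).
Proof.
move=> b03.
set bad := fun u : 'cV['F_2]_m =>
  ~~ ((1 - beta) * m%:R / 2 <= (wt u)%:R <= (1 + beta) * m%:R / 2).
have p0 w : 0 <= bernoulli_wt R m 2^-1 w by apply: bernoulli_wt_ge0; lra.
have translate x : \sum_(w | bad (w + C *m x)) bernoulli_wt R m 2^-1 w =
    \sum_(u | bad u) bernoulli_wt R m 2^-1 u.
  rewrite [RHS](reindex_inj (addIr (C *m x))) /=.
  by apply: eq_bigr => w _; rewrite !bernoulli_half.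
apply: le_trans (_ : \sum_x \sum_(w | bad (w + C *m x)) bernoulli_wt R m 2^-1 w <= _).
  under [leRHS]eq_bigr do rewrite big_mkcond.
  rewrite exchange_big /= big_mkcond /=; apply: ler_sum => w _.
  have q0 x : 0 <= (if bad (w + C *m x) then bernoulli_wt R m 2^-1 w else 0).
    by case: ifP.
  case: ifP => [|_]; last by apply: sumr_ge0.
  rewrite negb_forall => /existsP[x bx].
  by rewrite (bigD1 x) //= ifT // lerDl; apply: sumr_ge0 => y _; apply: q0.
under eq_bigr do rewrite translate.
rewrite sumr_const cardT -cardE card_mx card_Fp // muln1 -[leLHS]mulr_natl natrX.
by rewrite ler_wpM2l ?exprn_ge0 // uniform_unbalanced.
Qed.

(** The two means agree if [h = 0] (both 1) or [h] is outside the dual (both 0). A nonzero dual [h]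
    has weight at least the dual distance, and [1 - eta <= expR (- eta)]. The division by 6 weakens
    the bound to match the Chernoff error. *)
Lemma character_gap (eta : R) h : 0 < eta < 1 ->
  `|0 ^+ wt (C^T *m h) * (1 - eta) ^+ wt h - 0 ^+ wt h| <=
  expR (- (eta * (dual_distance (code C))%:R / 6)).
Proof.
move=> eta01; have [->|h0] := eqVneq h 0.
  by rewrite mulmx0 !wt0 !expr0 mulr1 subrr normr0 expR_ge0.
rewrite [X in _ - X]expr0n wt_eq0 (negbTE h0) subr0 expr0n wt_eq0.
have [Ch0|_] := eqVneq (C^T *m h) 0; last by rewrite mul0r normr0 expR_ge0.
rewrite mul1r ger0_norm ?exprn_ge0 //; last by lra.
have le_d := dual_distance_le _ _ (mem_dual_code _ Ch0) h0.
apply: le_trans (_ : (1 - eta) ^+ dual_distance (code C) <= _).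
  by apply: ler_wiXn2l => //; lra.
apply: le_trans (_ : expR (- eta) ^+ dual_distance (code C) <= _).
  by rewrite lerXn2r ?nnegrE ?expR_ge0 ?expR_ge1Dx //; lra.
rewrite -expRM_natl ler_expR.
have : 0 <= (dual_distance (code C))%:R :> R by rewrite ler0n.
nra.
Qed.

(** * Means of the statistic under the two inputs *)

Section Statistic.
Variables (N : nat) (H : 'M['F_2]_(N, m)) (b : 'cV['F_2]_N).
Local Notation A := (statistic R H b).

Lemma statisticE w : A w = \sum_i sgn2 R (b i 0) * sgn2 R (dotp (row i H)^T w).
Proof. by apply: eq_bigr => i _; rewrite mulrC -sgn2D. Qed.

Lemma statistic_int w : exists z : int, A w = z%:~R.
Proof.
exists (\sum_(i < N) (-1) ^+ nat_of_ord (dotp (row i H)^T w + b i 0)).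
by rewrite rmorph_sum; apply: eq_bigr => i _; rewrite rmorphXn rmorphN1.
Qed.

Lemma norm_statistic w : `|A w| <= N%:R.
Proof.
rewrite -[N in leRHS]card_ord -sumr_const; apply: le_trans (ler_norm_sum _ _ _) _.
by apply: ler_sum => i _; rewrite norm_sgn2.
Qed.

Lemma mean_statistic (T : finType) (p : T -> R) (f : T -> 'cV['F_2]_m) :
  \sum_t p t * A (f t) =
  \sum_i sgn2 R (b i 0) * \sum_t p t * sgn2 R (dotp (row i H)^T (f t)).
Proof.
under eq_bigr do rewrite statisticE mulr_sumr.
rewrite exchange_big; apply: eq_bigr => i _; rewrite mulr_sumr.
by apply: eq_bigr => t _; rewrite mulrCA.
Qed.

(** The means are compared row by row; the shift only changes signs, so each of the [N] rows costs
    at most one character gap. *)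
Lemma mean_statistic_gap (eta : R) : 0 < eta < 1 ->
  \sum_t noisy_wt (eta / 2) t * A (C *m t.1 + t.2) <=
  \sum_w bernoulli_wt R m 2^-1 w * A w +
  N%:R * expR (- (eta * (dual_distance (code C))%:R / 6)).
Proof.
move=> eta01; rewrite -lerBlDl !mean_statistic -sumrB.
rewrite -[N in leRHS]card_ord mulr_natl -sumr_const; apply: ler_sum => i _.
rewrite noisy_character bernoulli_character divff ?pnatr_eq0 // subrr.
have -> : 2 * (eta / 2) = eta by field.
rewrite -mulrBr; apply: le_trans (ler_norm _) _.
by rewrite normrM norm_sgn2 mul1r character_gap.
Qed.

End Statistic.

(** The contradiction for acceptance by [T <= A], to which the other mode reduces. *)
Lemma no_threshold_gap (eta : R) N (H : 'M['F_2]_(N, m)) (b : 'cV['F_2]_N) (T : R) :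
  (0 < n)%N -> (n < m)%N -> 0 < eta < 1 ->
  N%:R < 7^-1 * expR (Num.min (eta * (dual_distance (code C))%:R / 6) (3 * n%:R)) ->
  (forall w, close_to eta (code C) w -> T <= statistic R H b w) ->
  (forall w, separated_from (3 * Num.sqrt (n%:R / m%:R) : R) (code C) w ->
     statistic R H b w < T) -> False.
Proof.
move=> n0 nm eta01 Nlt closeT sepT.
set d := dual_distance (code C) in Nlt *; set beta := 3 * _ in sepT.
set A := statistic R H b in closeT sepT *; set M := Num.min _ _ in Nlt.
have m0 : 0 < m%:R :> R by rewrite ltr0n (leq_trans _ nm).
have nm_sqr : Num.sqrt (n%:R / m%:R) ^+ 2 = n%:R / m%:R :> R.
  by rewrite sqr_sqrtr // divr_ge0.
have beta03 : 0 <= beta <= 3.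
  rewrite /beta; have := sqrtr_ge0 (n%:R / m%:R : R).
  suff : Num.sqrt (n%:R / m%:R) <= 1 :> R by lra.
  by rewrite -[leRHS]sqrtr1 ler_sqrt // ler_pdivrMr // mul1r ler_nat ltnW.
have A_ge w : - N%:R <= A w by have := norm_statistic _ H b w; rewrite ler_norml => /andP[].
have A_le w : A w <= N%:R by have := norm_statistic _ H b w; rewrite ler_norml => /andP[].
have e1 : expR (- (eta * d%:R / 6)) <= expR (- M) by rewrite ler_expR lerN2 ge_min lexx.
have e2 : expR (- (3 * n%:R)) <= expR (- M) by rewrite ler_expR lerN2 ge_min lexx orbT.
have far : \sum_(t | ~~ ((code_dist (code C) (C *m t.1 + t.2))%:R <= eta * m%:R))
    noisy_wt (eta / 2) t <= expR (- M).
  apply: le_trans (noisy_far eta eta01) (le_trans _ e1).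
  have : d%:R <= m%:R :> R by rewrite ler_nat dual_distance_le_length.
  by rewrite ler_expR; nra.
have nsep : \sum_(w | ~~ separatedb beta w) bernoulli_wt R m 2^-1 w <=
    2 * expR (- (3 * n%:R)).
  apply: le_trans (uniform_not_separated beta beta03) _.
  have -> : 4 / 9 * beta ^+ 2 * m%:R = 4 * n%:R.
    rewrite /beta exprMn nm_sqr; field; lra.
  rewrite mulrCA ler_wpM2l //.
  (* The number of messages [2 ^+ n] is at most [expR 1 ^+ n], which uses up one of the four [n] in
     the exponent. *)
  apply: le_trans (_ : expR 1 ^+ n * expR (- (4 * n%:R)) <= _).
    rewrite ler_wpM2r ?expR_ge0 // lerXn2r ?nnegrE ?expR_ge0 //.
    by apply: le_trans (expR_ge1Dx _); lra.
  by rewrite -expRM_natl -expRD ler_expR; lra.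
(* A separated word exists because [2 * expR (- (3 * n%:R)) < 1]; it yields [- N%:R <= k - 1], as
   [mean_le] requires. *)
have [w0 sep0] : exists w, separatedb beta w.
  apply/existsP; apply: contraT; rewrite negb_exists => /forallP nosep.
  have : 1 <= 2 * expR (- (3 * n%:R)) :> R.
    apply: le_trans nsep; rewrite -[leLHS](bernoulli_sum1 R m 2^-1) le_eqVlt.
    by apply/orP; left; apply/eqP; apply: eq_bigl => w; rewrite nosep.
  have : 1 + 3 * n%:R <= expR (3 * n%:R) :> R by exact: expR_ge1Dx.
  have : 1 <= n%:R :> R by rewrite ler1n.
  have : expR (3 * n%:R) * expR (- (3 * n%:R)) = 1 :> R by rewrite -expRD subrr expR0.
  have := expR_ge0 (- (3 * n%:R) : R); nra.
(* A is integer valued, so rounding T up leaves a gap of 1. *)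
set k : R := (Num.ceil T)%:~R.
have close_k w : close_to eta (code C) w -> k <= A w.
  move=> /closeT; rewrite /A; have [z ->] := statistic_int _ H b w.
  by rewrite -ceil_le_int ler_int.
have sep_k w : separatedb beta w -> A w <= k - 1.
  move=> /separatedbP /sepT; rewrite /A; have [z ->] := statistic_int _ H b w.
  rewrite -ceil_gt_int -lezD1 => zT.
  by rewrite lerBrDr -[1]/(1%:~R) -intrD ler_int.
(* The zero word yields [k <= N%:R], as [mean_ge] requires. *)
have close0 : close_to eta (code C) 0.
  rewrite /close_to.
  have := code_dist_le 0 0; rewrite mulmx0 addr0.
  by rewrite wt0 leqn0 => /eqP ->; nra.
have k_le : k <= N%:R by apply: le_trans (close_k _ close0) (A_le _).
have k_ge : - N%:R <= k - 1 by apply: le_trans (A_ge _) (sep_k _ sep0).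
have r01 : 0 <= eta / 2 <= 1 by lra.
have noisy_mean := @mean_ge R _ (noisy_wt (eta / 2)) (fun t => A (C *m t.1 + t.2))
  (fun t => (code_dist (code C) (C *m t.1 + t.2))%:R <= eta * m%:R) k N%:R
  (fun t => noisy_wt_ge0 _ t r01) (noisy_sum1 _) (fun t => A_ge _)
  (fun t => close_k _) k_le.
have half01 : 0 <= (2^-1 : R) <= 1 by lra.
have unif_mean := @mean_le R _ (bernoulli_wt R m 2^-1) A (separatedb beta) (k - 1) N%:R
  (fun w => bernoulli_wt_ge0 R m _ w half01) (bernoulli_sum1 R m _) A_le sep_k k_ge.
have gap := mean_statistic_gap N H b eta eta01; rewrite -/A -/d in gap.
have Meq : expR M * expR (- M) = 1 by rewrite -expRD subrr expR0.
have eM0 : 0 < expR (- M) by exact: expR_gt0.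
have N0 : 0 <= N%:R :> R by rewrite ler0n.
(* With [E = N%:R * expR (- M)], the noisy mean is at least [k - 2 * E], the uniform mean at most
   [k - 1 + 4 * E], and their gap at most [E]. Hence [1 <= 7 * E], which is where the 7 comes
   from. *)
have NM : 7 * (N%:R * expR (- M)) < 1.
  by rewrite -[ltRHS]Meq mulrA ltr_pM2r //; lra.
have b1 := ler_wpM2l N0 far.
have b2 := ler_wpM2l N0 (le_trans nsep (ler_wpM2l (ler0n R 2) e2)).
have b3 := ler_wpM2l N0 e1.
lra.
Qed.

End Code.

(** Complementing the shift turns acceptance by [A <= T] into acceptance by [- T <= - A], so only
    one mode needs an argument. *)
Lemma statistic_flip (R : realType) m N (H : 'M['F_2]_(N, m)) (b : 'cV['F_2]_N) w :
  statistic R H (b + const_mx 1) w = - statistic R H b w.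
Proof.
rewrite !statisticE -sumrN; apply: eq_bigr => i _.
by rewrite !mxE sgn2D sgn21 mulrN1 mulNr.
Qed.

Theorem theorem4p1 (R : realType) (n m d : nat) (eta : R)
  (n_gt0 : (0 < n)%N) (m_gt0 : (0 < m)%N) (d_gt0 : (0 < d)%N)
  (n_lt_m : (n < m)%N) (eta_gt0 : 0 < eta) (eta_lt1 : eta < 1)
  (C : 'M['F_2]_(m, n)) (C_full : \rank C = n)
  (C_dual : dual_distance (code C) = d)
  (N : nat)
  (N_lt : N%:R < 7^-1 * expR (Num.min (eta * d%:R / 6) (3 * n%:R))) :
  let beta : R := 3 * Num.sqrt (n%:R / m%:R) in
  ~ exists D : threshold_distinguisher m R N,
      (forall w : 'cV['F_2]_m, close_to eta (code C) w -> accepts D w) /\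
      (forall w : 'cV['F_2]_m, separated_from beta (code C) w -> ~ accepts D w).
Proof.
move=> beta [[H b T mode] [acc rej]].
have eta01 : 0 < eta < 1 by rewrite eta_gt0 eta_lt1.
rewrite -C_dual in N_lt.
case: mode acc rej => acc rej.
- apply: (no_threshold_gap R m n C eta N H b T) => // w /rej.
  by rewrite /accepts /= => /negP; rewrite -ltNge.
- apply: (no_threshold_gap R m n C eta N H (b + const_mx 1) (- T)) => // w.
    by move=> /acc; rewrite statistic_flip lerN2.
  by move=> /rej; rewrite /accepts /= => /negP; rewrite -ltNge statistic_flip ltrN2.
Qed.
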